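(* Let $\{\mathcal{R}_A\}$ be a zero-divisor functorial family. Then its associated zero-divisor functor $\zeta:\mathbf{CRing}\to\mathbf{Graph}$ preserves equalizers if and only if $\mathcal{R}_A$ is the equality relation $=_A$ for every ring $A$.
   Context: $\mathbf{CRing}$ is the category of commutative unitary rings with homomorphisms preserving $1$. $\mathbf{Graph}$ is the category whose objects are graphs (a set $V$ with a symmetric binary relation $E$ on $V$; loops allowed) and whose morphisms are maps on vertices sending adjacent pairs to adjacent pairs. An equivalence relation $\mathcal{R}$ on a ring $A$ is a zero-divisor relation if, whenever $a\,\mathcal{R}\,a'$ and $b\,\mathcal{R}\,b'$, $ab=0$ implies $a'b'=0$. A zero-divisor functorial family $\{\mathcal{R}_A\}$ is a choice, for each ring $A$, of a zero-divisor relation $\mathcal{R}_A$ on $A$ such that for every ring homomorphism $f:A\to B$, $a\,\mathcal{R}_A\,a'$ implies $f(a)\,\mathcal{R}_B\,f(a')$. Its associated zero-divisor functor $\zeta$ sends $A$ to the graph $\zeta(A)$ with vertex set $A/\mathcal{R}_A$ in which $[a],[b]$ are adjacent iff $ab=0$, and sends $f:A\to B$ to $\zeta(f):[a]\mapsto[f(a)]$. Equalizers: in $\mathbf{CRing}$, $\operatorname{Eq}(f,g)=\{a: f(a)=g(a)\}$; in $\mathbf{Graph}$, $\operatorname{Eq}(\alpha,\beta)$ is the subgraph induced by the vertices on which $\alpha,\beta$ coincide. $\zeta$ preserves equalizers if for all $f,g:A\to B$ the canonical morphism $\zeta(\operatorname{Eq}(f,g))\to\operatorname{Eq}(\zeta(f),\zeta(g))$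 is an isomorphism. *)

(* Defs.v *)
From HB Require Import structures.
From mathcomp Require Import all_boot all_algebra.
From mathcomp Require Import boolp.
From Stdlib Require Import RelationClasses.
Set Implicit Arguments.
Unset Strict Implicit.
Unset Printing Implicit Defensive.

Import GRing.Theory.
Local Open Scope ring_scope.
Local Open Scope quotient_scope.

(* Commutative unitary rings are comPzRingType rather than comNzRingType: the  *)
(* zero ring is an object of CRing. A comPzRingType also carries a choice      *)
(* operator; it has no influence on the relations below, since functoriality   *)
(* along the identity map identifies the relations attached to two such        *)
(* structures on the same ring.                                                *)

Record graph := Graph {
  vertex : Type;
  adj : vertex -> vertex -> Prop;
  adj_sym : forall x y, adj x y -> adj y x
}.

Record ghom (G H : graph) := Ghom {
  ghom_fun :> vertex G -> vertex H;
  ghom_adj : forall x y, adj x y -> adj (ghom_fun x) (ghom_fun y)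
}.

Definition graph_iso (G H : graph) (h : ghom G H) : Prop :=
  exists k : ghom H G, cancel h k /\ cancel k h.

Section GraphEqualizer.
Variables (G H : graph) (alpha beta : ghom G H).

Definition graph_eq_vertex := {x : vertex G | alpha x = beta x}.

Definition graph_eq_adj (x y : graph_eq_vertex) : Prop :=
  adj (proj1_sig x) (proj1_sig y).

Lemma graph_eq_adj_sym x y : graph_eq_adj x y -> graph_eq_adj y x.
Proof. exact: adj_sym. Qed.

Definition graph_eq : graph := Graph graph_eq_adj_sym.

Section Lift.
Variables (K : graph) (h : ghom K G).
Variable hE : forall x, alpha (h x) = beta (h x).

Definition graph_eq_lift_fun (x : vertex K) : vertex graph_eq :=
  exist _ (h x) (hE x).

Lemma graph_eq_lift_adj x y :
  adj x y -> adj (graph_eq_lift_fun x) (graph_eq_lift_fun y).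
Proof. exact: ghom_adj. Qed.

Definition graph_eq_lift : ghom K graph_eq := Ghom graph_eq_lift_adj.
End Lift.
End GraphEqualizer.

Section RingEqualizer.
Variables (A B : comPzRingType) (f g : {rmorphism A -> B}).

Definition ring_eq_pred : {pred A} := fun a => `[< f a = g a >].

Lemma ring_eqP a : a \in ring_eq_pred <-> f a = g a.
Proof. by split=> /asboolP. Qed.

Lemma ring_eq_subring : subring_closed ring_eq_pred.
Proof.
split=> [|a b /ring_eqP ab /ring_eqP cd|a b /ring_eqP ab /ring_eqP cd];
  apply/ring_eqP.
- by rewrite !rmorph1.
- by rewrite !rmorphB ab cd.
- by rewrite !rmorphM ab cd.
Qed.

Record ring_eq := RingEq {
  ring_eq_val :> A;
  ring_eq_valP : ring_eq_val \in ring_eq_pred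
}.

HB.instance Definition _ := [isSub for ring_eq_val].
HB.instance Definition _ := [Choice of ring_eq by <:].
HB.instance Definition _ :=
  GRing.SubChoice_isSubComPzRing.Build A ring_eq_pred ring_eq ring_eq_subring.

Definition ring_eq_incl : {rmorphism ring_eq -> A} := val.

Lemma ring_eq_inclE (a : ring_eq) : f (ring_eq_incl a) = g (ring_eq_incl a).
Proof. exact/ring_eqP/(valP a). Qed.
End RingEqualizer.

Definition zero_divisor_relation (A : comPzRingType) (R : A -> A -> Prop) :=
  Equivalence R /\
  forall a a' b b' : A, R a a' -> R b b' -> a * b = 0 -> a' * b' = 0.

Record zd_functorial_family := ZdFunctorialFamily {
  zd_rel :> forall A : comPzRingType, A -> A -> Prop;
  zd_relP : forall A : comPzRingType, zero_divisor_relation (@zd_rel A);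
  zd_functorial : forall (A B : comPzRingType) (f : {rmorphism A -> B})
    (a a' : A), zd_rel a a' -> zd_rel (f a) (f a')
}.

Section ZeroDivisorFunctor.
Variable R : zd_functorial_family.

Section Objects.
Variable A : comPzRingType.

Definition zd_relb : rel A := fun a b => `[< R A a b >].

Lemma zd_relb_refl : reflexive zd_relb.
Proof. by move=> a; apply/asboolP; have [[Rr _ _] _] := zd_relP R A. Qed.

Lemma zd_relb_sym : symmetric zd_relb.
Proof.
have [[_ Rs _] _] := zd_relP R A.
by move=> a b; apply/asboolP/asboolP; apply: Rs.
Qed.

Lemma zd_relb_trans : transitive zd_relb.
Proof.
have [[_ _ Rt] _] := zd_relP R A.
by move=> b a c /asboolP ab /asboolP bc; apply/asboolP; apply: Rt bc.
Qed.

Definition zd_equiv : equiv_rel A :=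
  EquivRel zd_relb zd_relb_refl zd_relb_sym zd_relb_trans.

Definition zd_quot := {eq_quot zd_equiv}.

Definition zd_class (a : A) : zd_quot := \pi_zd_quot a.

Lemma zd_class_eq a b : zd_class a = zd_class b <-> R A a b.
Proof.
split; first by move/eqmodP/asboolP.
by move=> ab; apply/eqmodP/asboolP.
Qed.

Lemma zd_class_repr x : zd_class (repr x) = x.
Proof. exact: reprK. Qed.

Lemma repr_zd_class a : R A (repr (zd_class a)) a.
Proof. by apply/zd_class_eq; rewrite zd_class_repr. Qed.

Definition zeta_adj (x y : zd_quot) : Prop := repr x * repr y = 0.

Lemma zeta_adjE a b : zeta_adj (zd_class a) (zd_class b) <-> a * b = 0.
Proof.
have [[_ Rs _] Rz] := zd_relP R A.
split; apply: Rz; solve [exact: repr_zd_class | exact/Rs/repr_zd_class].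
Qed.

Lemma zeta_adj_sym x y : zeta_adj x y -> zeta_adj y x.
Proof. by rewrite /zeta_adj mulrC. Qed.

Definition zeta : graph := Graph zeta_adj_sym.
End Objects.

Section Morphisms.
Variables (A B : comPzRingType) (f : {rmorphism A -> B}).

Definition zeta_map_fun (x : vertex (zeta A)) : vertex (zeta B) :=
  zd_class (f (repr x)).

Lemma zeta_map_adj x y : adj x y -> adj (zeta_map_fun x) (zeta_map_fun y).
Proof.
by move=> xy; apply/zeta_adjE; rewrite -rmorphM [repr x * _]xy rmorph0.
Qed.

Definition zeta_map : ghom (zeta A) (zeta B) := Ghom zeta_map_adj.

Lemma zeta_mapE a : zeta_map (zd_class a) = zd_class (f a).
Proof. exact/zd_class_eq/zd_functorial/repr_zd_class. Qed.
End Morphisms.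

Lemma zeta_map_id (A : comPzRingType) x :
  zeta_map (idfun : {rmorphism A -> A}) x = x.
Proof. exact: zd_class_repr. Qed.

Lemma zeta_map_comp (A B C : comPzRingType) (g : {rmorphism B -> C})
    (f : {rmorphism A -> B}) x :
  zeta_map (g \o f : {rmorphism A -> C}) x = zeta_map g (zeta_map f x).
Proof. by rewrite -[x]zd_class_repr !zeta_mapE. Qed.

Section Comparison.
Variables (A B : comPzRingType) (f g : {rmorphism A -> B}).

Lemma zeta_map_eq_incl x :
  zeta_map f (zeta_map (ring_eq_incl f g) x) =
  zeta_map g (zeta_map (ring_eq_incl f g) x).
Proof. by rewrite -[x]zd_class_repr !zeta_mapE ring_eq_inclE. Qed.

(* The unique morphism whose composite with the inclusion of the equalizer of  *)
(* zeta f and zeta g is the image under zeta of the inclusion of Eq(f, g).     *)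
Definition zeta_comparison :
    ghom (zeta (ring_eq f g)) (graph_eq (zeta_map f) (zeta_map g)) :=
  graph_eq_lift zeta_map_eq_incl.
End Comparison.

Definition zeta_preserves_equalizers : Prop :=
  forall (A B : comPzRingType) (f g : {rmorphism A -> B}),
    graph_iso (zeta_comparison f g).
End ZeroDivisorFunctor.

(* Main.v *)
Require Import Defs.
From mathcomp Require Import all_boot all_algebra.
From HB Require Import structures.
From mathcomp Require Import boolp.
(** For the nontrivial implication, let [R A a a'] and let [f], [g] be the maps
    from Z[X] to [A] with [f 'X = a] and [g 'X = a']. The class of ['X] is a
    vertex of the equalizer of [zeta f] and [zeta g], so if [zeta] preserves
    this equalizer, some [q] with [f q = g q] is related to ['X]
    ([equalizer_lift]). It remains to see that [q] cannot differ from ['X] by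
    more than a sign.

    Related elements [b], [c] of a ring divide one another ([zd_rel_dvd]): in
    the quotient by the ideal of [b], the image of [c] is related to 0, and an
    element related to 0 is 0 because its product with 1 must vanish. Hence
    ['X = r * q] with [r] a unit of Z[X]. Such a unit is an integer constant, on
    which all ring morphisms agree, so
    [a = f r * f q = g r * g q = a'] ([zd_rel_eq]).

    Conversely, if every [R A] is equality, passing to classes is a bijection
    and the two equalizers have the same vertices and the same adjacency. *)

Set Implicit Arguments.
Unset Strict Implicit.
Unset Printing Implicit Defensive.

Import GRing.Theory.
Local Open Scope ring_scope.
Local Open Scope quotient_scope.

Section PrincipalIdeal.
Variables (A : comNzRingType) (a : A).

Definition principal : {pred A} := fun x => `[< exists c, x = c * a >].

Lemma principalP x : x \in principal <-> exists c, x = c * a.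
Proof. by split=> /asboolP. Qed.

Definition principal_proper := 1 \notin principal.

Lemma principal_idealr_closed : principal_proper -> idealr_closed principal.
Proof.
split=> // [|b x y /principalP[c ->] /principalP[d ->]]; apply/principalP.
  by exists 0; rewrite mul0r.
by exists (b * c + d); rewrite mulrDl mulrA.
Qed.

(** Only the existence of a quotient map with kernel the ideal of [a] matters
    below. Properness is assumed because the construction lands in rings with
    [1 != 0]. *)
Lemma principal_quotient : principal_proper ->
  exists (Q : comPzRingType) (p : {rmorphism A -> Q}),
    forall x, p x = 0 <-> exists c, x = c * a.
Proof.
move=> /principal_idealr_closed cl.
pose I : idealr A := HB.pack_for (idealr A) principal
  (isIdealr.Build _ _ cl).
exists {ideal_quot I}, (\pi_{ideal_quot I} : {rmorphism A -> {ideal_quot I}}).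
move=> x; rewrite -principalP.
have -> : (x \in principal) = (x == 0 %[mod {ideal_quot I}]).
  by rewrite -Quotient.idealrBE subr0.
by rewrite /= rmorph0; split=> [-> | /eqP].
Qed.

End PrincipalIdeal.

(** The image of [b] modulo [a] is related to 0, hence is 0. When [a] is a unit
    the quotient would be the zero ring, and divisibility holds outright. *)
Lemma zd_rel_dvd (R : zd_functorial_family) (A : comNzRingType) (a b : A) :
  R A a b -> exists c, b = c * a.
Proof.
move=> ab; have [/principalP[c c1]|] := boolP (1 \in principal a).
  by exists (b * c); rewrite -mulrA -c1 mulr1.
move=> /principal_quotient[Q [p pE]]; apply/pE.
have pa : p a = 0 by apply/pE; exists 1; rewrite mul1r.
have [[Rr _ _] Rz] := zd_relP R Q.
by rewrite -[p b]mulr1; apply: Rz (zd_functorial p ab) (Rr 1) _; rewrite mulr1.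
Qed.

(** Evaluation of polynomials takes values in rings with [1 != 0], so the
    hypothesis serves to give [A] such a structure. *)
Lemma poly_int_eval (A : comPzRingType) (a : A) : (1 : A) != 0 ->
  exists f : {rmorphism {poly int} -> A}, f 'X = a.
Proof.
move=> A1.
pose A' : comNzRingType := HB.pack_for comNzRingType (GRing.ComPzRing.sort A)
  (GRing.PzSemiRing_isNonZero.Build (GRing.ComPzRing.sort A) A1).
have cfu : commr_rmorph (intr : int -> A') a by move=> n; apply: mulrC.
pose f : {rmorphism {poly int} -> A'} := horner_morph cfu.
exists ((idfun : {rmorphism A' -> A}) \o f).
by rewrite /= horner_morphX.
Qed.

(** A unit of Z[X] has degree 0, so it lies in the image of Z, where a ring
    morphism leaves no choice. *)
Lemma unit_poly_int_agree (A : comPzRingType)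
    (f g : {rmorphism {poly int} -> A}) (r s : {poly int}) :
  s * r = 1 -> f r = g r.
Proof.
move=> sr1; have /size_poly1P[n _ ->] : size r == 1%N.
  have : size (s * r) == 1%N by rewrite sr1 size_poly1.
  by rewrite size_mul_eq1 => /andP[].
by rewrite -[n]intz rmorph_int !rmorph_int.
Qed.

(** This is surjectivity of the comparison morphism: when [f x] and [g x] are
    related, the class of [x] is a vertex of the graph equalizer, and it must
    come from an element of the ring equalizer. *)
Lemma equalizer_lift (R : zd_functorial_family) (A B : comPzRingType)
    (f g : {rmorphism A -> B}) (x : A) :
    zeta_preserves_equalizers R -> R B (f x) (g x) ->
  exists2 y, f y = g y & R A y x.
Proof.
move=> pres fgx; have [k [_ kK]] := pres _ _ f g.
have xE : zeta_map R f (zd_class R x) = zeta_map R g (zd_class R x).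
  by rewrite !zeta_mapE; apply/zd_class_eq.
have /(congr1 (@proj1_sig _ _)) /= :=
  kK (exist _ _ xE : vertex (graph_eq (zeta_map R f) (zeta_map R g))).
move: (k _) => z; rewrite -[z]zd_class_repr.
rewrite -[zeta_map_fun _ _]/(zeta_map R _ _) zeta_mapE => /zd_class_eq zx.
by exists (ring_eq_incl f g (repr z)) => //; apply: ring_eq_inclE.
Qed.

(** The universal instance: Z[X] with its two evaluations at [a] and [a'], and
    the lifting of ['X] to the equalizer. *)
Lemma zd_rel_eq (R : zd_functorial_family) (A : comPzRingType) (a a' : A) :
  zeta_preserves_equalizers R -> R A a a' -> a = a'.
Proof.
move=> pres aa'; have [A0|A1] := eqVneq (1 : A) 0.
  by rewrite -[a]mulr1 -[a']mulr1 A0 !mulr0.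
have [[f fX] [g gX]] := (poly_int_eval a A1, poly_int_eval a' A1).
have [q fgq qX] : exists2 q, f q = g q & R {poly int} q 'X.
  by apply: equalizer_lift => //; rewrite fX gX.
have [r Xr] := zd_rel_dvd qX.
have [[_ Rs _] _] := zd_relP R {poly int}.
have [c qc] := zd_rel_dvd (Rs _ _ qX).
have X0 : 'X != 0 :> {poly int} by rewrite -size_poly_eq0 size_polyX.
have cr1 : c * r = 1.
  by apply: (mulIf X0); rewrite mul1r mulrAC -qc mulrC -Xr.
by rewrite -fX -gX Xr !rmorphM fgq (unit_poly_int_agree f g cr1).
Qed.

Theorem proposition3p16 (R : zd_functorial_family) :
  zeta_preserves_equalizers R <->
  (forall (A : comPzRingType) (a a' : A), R A a a' <-> a = a').
Proof.
split=> [pres A a a'|Req A B f g].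
  split=> [|->]; first exact: zd_rel_eq.
  by have [[Rr _ _] _] := zd_relP R A; apply: Rr.
have classI (C : comPzRingType) : injective (@zd_class R C).
  by move=> x y /zd_class_eq /Req.
(* Class representatives are exact here, so the representative of a vertex of
   the graph equalizer already lies in the ring equalizer. *)
have fgr (x : vertex (graph_eq (zeta_map R f) (zeta_map R g))) :
    repr (proj1_sig x) \in ring_eq_pred f g.
  by apply/ring_eqP; apply: classI; rewrite -!zeta_mapE zd_class_repr (proj2_sig x).
pose kf x : vertex (zeta R (ring_eq f g)) := zd_class R (RingEq (fgr x)).
have kadj x y : adj x y -> adj (kf x) (kf y).
  by move=> xy; apply/zeta_adjE/val_inj.
exists (Ghom kadj); split=> x /=.
  rewrite -[RHS]zd_class_repr; congr zd_class; apply: val_inj => /=.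
  by apply/classI; rewrite zd_class_repr.
case: x => x fgx; apply: eq_exist.
by rewrite -[LHS]/(zeta_map R _ (kf _)) zeta_mapE /= zd_class_repr.
Qed.
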